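(* Let $H$ be a simple hypergraph with $e$-index $k$. Then $$\det(\mathbf{U}(H))=\sum (-1)^{k-c(H')-e(H')}\,2^{c(H')},$$ where the summation is over all elementary $k$-subhypergraphs $(H',\mathcal{C}(H'),\mathcal{E}(H'))_k$ of $H$, and $c(H')=|\mathcal{C}(H')|$, $e(H')=|\mathcal{E}(H')|$.
   Context: A hypergraph $H$ consists of a finite non-empty vertex set $V(H)$ and a multiset $E(H)$ of non-empty subsets of $V(H)$, called edges. It is simple if it has neither loops (edges of cardinality one) nor multiple edges. A subhypergraph of $H$ is a hypergraph $H'$ with $V(H')\subseteq V(H)$ and $E(H')\subseteq E(H)$. A 2-partition of a set $e$ is an unordered pair $\{S,S'\}$ of non-empty disjoint sets with $S\cup S'=e$; $S$ and $S'$ are called parts of $e$. $I(H)$ is the set of all parts of all edges of $H$ together with all singleton subsets of $V(H)$, and $k=|I(H)|$ is the $e$-index of $H$. For simple $H$, the unified matrix $\mathbf{U}(H)$ is the $k\times k$ matrix with rows and columns indexed by $I(H)$ whose $(S,S')$ entry is $1$ if $\{S,S'\}$ is a 2-partition of an edge of $H$, and $0$ otherwise. An exact walk in $H$ is a sequence $S_0,e_1,S_1,e_2,S_2,\dots,e_n,S_n$ such that $\{S_{i-1},S_i\}$ is a 2-partition of the edge $e_i$ of $H$ for $i=1,\dots,n$. The sets $S_0,\dots,S_n$ are its parts, $S_0$ is its initial part, $S_n$ is its terminal part, and the other parts are internal; its cover is the set of all its parts, and its length is $n$. An exact cycle is an exact walk with at least three distinct edges whose initial and terminal parts are the same and whose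 internal parts are all distinct; $l(C)$ denotes the length of an exact cycle $C$. Two exact walks (in particular, two exact cycles) are disjoint if their sets of parts are disjoint. For $q\in\{2,3,\dots,k\}$, a triplet $(H',\mathcal{C}(H'),\mathcal{E}(H'))_q$ is an elementary $q$-subhypergraph of $H$ if: (i) $H'$ is a subhypergraph of $H$; (ii) $\mathcal{C}(H')$ is a set which is either empty or consists of some disjoint exact cycles $C_1,\dots,C_r$ in $H'$, and $\mathcal{E}(H')$ is a set which is either empty or consists of 2-partitions of some edges $e_1,\dots,e_t$ in $H'$, such that $\sum_{C\in\mathcal{C}(H')}l(C)+2|\mathcal{E}(H')|=q$; (iii) letting $\mathcal{C}^*(H')$ denote the union of the covers of the disjoint exact cycles in $\mathcal{C}(H')$, if $S\in\mathcal{C}^*(H')\cup\left(\bigcup_{T\in\mathcal{E}(H')}T\right)$, then $S$ belongs to either $\mathcal{C}^*(H')$ or at most one set in $\mathcal{E}(H')$.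
   Formalization: In an elementary subhypergraph, H' is required to consist exactly of the edges used by the cycles and 2-partitions and their vertices (otherwise the 4-cycle graph gives 6, not 0), and exact cycles are identified when they differ only in starting part or direction. *)

(* Defs.v *)
From HB Require Import structures.
From mathcomp Require Import all_boot all_order all_algebra.
From mathcomp Require Import boolp zify.

Set Implicit Arguments.
Unset Strict Implicit.
Unset Printing Implicit Defensive.

Import GRing.Theory.

(* A simple hypergraph has no repeated edges, so its edge multiset is a set;
   "no loops" and "no empty edges" together say that edges have at least two
   elements.  Vertex sets live in an ambient finType so that subhypergraphs may
   have fewer vertices. *)
Definition simple_hypergraph_axiom (T : finType)
    (VE : {set T} * {set {set T}}) : bool :=
  (VE.1 != set0) && [forall e in VE.2, (e \subset VE.1) && (1 < #|e|)].

Record simple_hypergraph (T : finType) := SimpleHypergraph {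
  hypergraph_val :> {set T} * {set {set T}};
  _ : simple_hypergraph_axiom hypergraph_val
}.

HB.instance Definition _ (T : finType) :=
  [isSub for @hypergraph_val T].
HB.instance Definition _ (T : finType) :=
  [Countable of simple_hypergraph T by <:].
HB.instance Definition _ (T : finType) :=
  [Finite of simple_hypergraph T by <:].

Definition vertices (T : finType) (H : simple_hypergraph T) : {set T} := H.1.
Definition edges (T : finType) (H : simple_hypergraph T) : {set {set T}} :=
  H.2.

Definition subhypergraph (T : finType) (H' H : simple_hypergraph T) : bool :=
  (vertices H' \subset vertices H) && (edges H' \subset edges H).

Definition two_partitions (T : finType) (e : {set T}) : {set {set {set T}}} :=
  [set P : {set {set T}} | partition P e && (#|P| == 2)].

(* [cover (two_partitions e)] is the set of parts of [e]. *)
Definition index_set (T : finType) (H : simple_hypergraph T) : {set {set T}} :=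
  (\bigcup_(e in edges H) cover (two_partitions e))
    :|: [set [set v] | v in vertices H].

Definition e_index (T : finType) (H : simple_hypergraph T) : nat :=
  #|index_set H|.

Definition unified_matrix (R : comNzRingType) (T : finType)
    (H : simple_hypergraph T) : 'M[R]_(e_index H) :=
  \matrix_(i, j)
    (if [exists e in edges H,
           [set enum_val i; enum_val j] \in two_partitions e]
     then 1 else 0)%R.

(* The walk S_0, e_1, S_1, ..., e_n, S_n is encoded by S_0 and the sequence of
   pairs (e_i, S_i).  [traversed S0 w] lists the pairs {S_(i-1), S_i}. *)
Definition traversed (T : finType) (S0 : {set T})
    (w : seq ({set T} * {set T})) : seq {set {set T}} :=
  pairmap (fun S S' : {set T} => [set S; S']) S0 (unzip2 w).

Definition exact_walk (T : finType) (H : simple_hypergraph T) (S0 : {set T})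
    (w : seq ({set T} * {set T})) : bool :=
  all2 (fun e P => (e \in edges H) && (P \in two_partitions e))
    (unzip1 w) (traversed S0 w).

(* As S_n = S_0, [uniq (unzip2 w)] says that the internal parts are pairwise
   distinct and different from the initial (= terminal) part. *)
Definition exact_cycle_walk (T : finType) (H : simple_hypergraph T)
    (S0 : {set T}) (w : seq ({set T} * {set T})) : bool :=
  [&& exact_walk H S0 w, last S0 (unzip2 w) == S0, uniq (unzip2 w)
    & 3 <= size (undup (unzip1 w))].

(* Walks around the same cycle that differ by the starting part or the
   direction are the same exact cycle, so a cycle is encoded by the set of
   2-partitions that it traverses; this set determines the closed walk up to
   rotation and reversal.  Thus [cover C] is the set of parts of the cycle [C]
   (its cover), and [#|C|] is its length: see [card_traversed]. *)
Definition exact_cycle (T : finType) (H : simple_hypergraph T)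
    (C : {set {set {set T}}}) : bool :=
  `[< exists (S0 : {set T}) (w : seq ({set T} * {set T})),
        exact_cycle_walk H S0 w /\ C = [set P in traversed S0 w] >].

Lemma card_traversed (T : finType) (H : simple_hypergraph T) (S0 : {set T})
    (w : seq ({set T} * {set T})) :
  exact_cycle_walk H S0 w -> #|[set P in traversed S0 w]| = size w.
Proof.
case/and4P=> _ /eqP lastw uniqw sz3.
have n3 : 3 <= size (unzip2 w).
  rewrite size_map -(size_map fst w).
  exact: leq_trans sz3 (size_undup _).
rewrite cardsE -[RHS](size_map snd) -/(unzip2 w) /traversed.
rewrite -[RHS](size_pairmap (fun S S' : {set T} => [set S; S']) S0).
apply/card_uniqP.
set s := unzip2 w in lastw uniqw n3 *.
apply/(uniqP set0) => i j; rewrite !inE !size_pairmap => lti ltj.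
wlog leij : i j lti ltj / i <= j.
  move=> W; case: (leqP i j) => [|/ltnW] h; first exact: W.
  by move=> E; apply/esym; apply: W h (esym E).
rewrite !(nth_pairmap set0) //= => E.
have nthS (a b : nat) : a < size s -> b < size s ->
    nth set0 s a = nth set0 s b -> a = b.
  by move=> la lb /eqP; rewrite nth_uniq // => /eqP.
have : nth set0 s i \in [set nth set0 (S0 :: s) j; nth set0 s j].
  by rewrite -E !inE eqxx orbT.
rewrite !inE => /orP[] /eqP E1; last exact: nthS.
have : nth set0 (S0 :: s) i \in [set nth set0 (S0 :: s) j; nth set0 s j].
  by rewrite -E !inE eqxx.
case: j ltj leij E E1 => [|j] ltj leij E E1.
  by move: leij; rewrite leqn0 => /eqP.
have Eij : i = j by apply: nthS E1 => //; apply: ltnW.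
subst j; rewrite !inE => /orP[] /eqP E2.
  have : nth set0 s i.+1 \in [set nth set0 (S0 :: s) i; nth set0 s i].
    by rewrite E !inE eqxx orbT.
  by rewrite !inE E2 orbb => /eqP E3; apply: nthS => //; rewrite E3.
case: i lti ltj {leij E E1} E2 => [|i] lti ltj /= E2.
  have sz1 : (size s).-1 < size s by lia.
  have E3 : nth set0 s (size s).-1 = nth set0 s 1.
    by rewrite nth_last -E2 -lastw; case: (s) n3.
  by have := nthS _ _ sz1 ltj E3; lia.
by have := nthS _ _ (ltnW lti) ltj E2; lia.
Qed.

(* The triplet (H', C, E)_q.  Besides the subhypergraph and counting
   conditions, [H'] is required to consist exactly of the edges (and their
   vertices) used by [C] and [E]: otherwise one pair (C, E) would give several
   triplets that differ only by unused edges or vertices of [H'].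
   [cover P] is the edge that [P] is a 2-partition of, and
   [\bigcup_(c in C) cover c] is C^*(H').  The "either ... or" in the last
   condition is exclusive: a part of a cycle lies in no member of [E]. *)
Definition elementary_subhypergraph (T : finType) (H : simple_hypergraph T)
    (q : nat) (H' : simple_hypergraph T) (C : {set {set {set {set T}}}})
    (E : {set {set {set T}}}) : bool :=
  let Cstar := \bigcup_(c in C) cover c in
  [&& 2 <= q <= e_index H,
      subhypergraph H' H,
      edges H' == [set cover P | P in cover C :|: E],
      vertices H' == cover (edges H'),
      [forall c in C, exact_cycle H' c],
      [forall c in C, forall c' in C,
         (c != c') ==> [disjoint cover c & cover c']],
      E \subset \bigcup_(e in edges H') two_partitions e,
      \sum_(c in C) #|c| + 2 * #|E| == q
    & [forall S in Cstar :|: cover E,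
         if S \in Cstar then S \notin cover E
         else #|[set P in E | S \in P]| <= 1]].

(* Main.v *)
Require Import Defs.
From mathcomp Require Import all_boot all_order all_algebra.
From mathcomp Require Import perm boolp.

Set Implicit Arguments.
Unset Strict Implicit.
Unset Printing Implicit Defensive.

(** The unified matrix is the adjacency matrix of a loopless graph: its vertices
    are the parts and singletons in the index set, its edges are the
    2-partitions of the edges of the hypergraph.  The formula is the
    Harary-Sachs formula ([harary_sachs]) for this graph.

    In the Leibniz expansion only those permutations s survive for which every
    pair {x, s x} is an edge.  Such an s has no fixed point, and
    forgetting the orientation of its orbits leaves a spanning subgraph: orbits
    of length 2 give the edges of a matching, longer orbits give cycles
    ([spanning_elementary_perm]).  Every spanning subgraph made of disjoint
    cycles and edges comes from some permutation
    ([exists_perm_cycles_matching]), and from exactly 2^c of them if it has c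
    cycles, since the permutations with the same subgraph as s arise from s by
    reversing some of its long orbits ([fiber_perm_decomposition]).  The sign
    of s depends only on its number of orbits, which is the number of cycles
    plus the number of matching edges.

    It remains to identify spanning subgraphs of this kind with elementary
    k-subhypergraphs.  The requirement that an exact cycle have three distinct
    edges amounts to having length at least three ([exact_cycleP]), because
    two consecutive hypergraph edges of a closed walk through distinct parts
    differ and a walk alternating between two edges would make them equal
    ([card_cycle_edge_covers]).  The total length k forces disjoint cycles and
    2-partitions to use every element of the index set
    ([elementary_spanning]), and the subhypergraph is determined by the edges
    that the cycles and 2-partitions use
    ([elementary_subhypergraph_unique]). *)

(** * Sequences *)

Lemma pairmap_next (A : eqType) (B : Type) (f : A -> A -> B) x (p : seq A) :
  uniq (x :: p) ->
  pairmap f x (rcons p x) = [seq f y (next (x :: p) y) | y <- x :: p].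
Proof.
move=> Up; apply: (@eq_from_nth _ (f x x)).
  by rewrite size_pairmap size_rcons size_map.
move=> i; rewrite size_pairmap size_rcons => ip.
rewrite (nth_pairmap x) ?size_rcons // (nth_map x) //.
rewrite next_nth mem_nth // index_uniq // -rcons_cons !nth_rcons ip.
by congr f; case: ltnP => // ?; rewrite nth_default // if_same.
Qed.

Lemma all2_exists (A B : eqType) (r : A -> B -> bool) (s : seq A) (t : seq B) :
  all2 r s t -> {in t, forall y, exists x, r x y}.
Proof.
elim: s t => [|x s IH] [|y t] //= /andP[rxy rst] z; rewrite inE.
by case/orP=> [/eqP->|]; [exists x|apply: IH].
Qed.

(** * Cycles and spanning elementary subgraphs of a graph *)

Section CycleEdges.

Variable V : finType.
Implicit Types (s p : seq V) (c G : {set {set V}}) (x y a b : V).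

Lemma set2_eq x y a b :
  [set x; y] = [set a; b] -> (x = a /\ y = b) \/ (x = b /\ y = a).
Proof.
move=> E.
have: x \in [set a; b] by rewrite -E set21.
have: y \in [set a; b] by rewrite -E set22.
have: a \in [set x; y] by rewrite E set21.
have: b \in [set x; y] by rewrite E set22.
rewrite !inE.
by do 4![case/orP=> /eqP ?]; subst; auto.
Qed.

(** This is where cycles of length at least 3 differ from those of length 2: the
    two directions along the cycle are different at every vertex. *)
Lemma next_next_neq s x :
  uniq s -> 2 < size s -> x \in s -> next s (next s x) != x.
Proof.
move=> Us s3 /rot_to[i q Dq].
rewrite -!(next_rot i Us) Dq.
have: uniq (x :: q) by rewrite -Dq rot_uniq.
have: 2 < size (x :: q) by rewrite -Dq size_rot.
case: q {Dq} => [|a [|b q]] //= _ /and3P[].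
rewrite !inE !negb_or eqxx => /and3P[xa xb _] _ _.
by rewrite (eq_sym a) (negPf xa) eqxx eq_sym.
Qed.

Definition cycle_edges s : {set {set V}} := [set [set x; next s x] | x in s].

Lemma cover_cycle_edges s : cover (cycle_edges s) = [set x in s].
Proof.
apply/setP=> y; rewrite inE; apply/bigcupP/idP.
  case=> _ /imsetP[x sx ->]; rewrite !inE => /orP[] /eqP-> //.
  by rewrite mem_next.
by move=> sy; exists [set y; next s y]; rewrite ?set21 //; apply: imset_f.
Qed.

Lemma card_cycle_edges s :
  uniq s -> 2 < size s -> #|cycle_edges s| = size s.
Proof.
move=> Us s3; rewrite card_in_imset ?(card_uniqP Us) // => x y sx sy.
case/set2_eq=> [[]|[Ex Ey]] //.
by have := next_next_neq Us s3 sx; rewrite Ey -Ex eqxx.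
Qed.

(** A graph is given by its set [G] of edges, each an unordered pair, and a
    cycle, up to rotation and reversal, by the set of edges it runs through. *)
Definition graph_cycle G c : Prop :=
  exists s, [/\ uniq s, 2 < size s, c = cycle_edges s & c \subset G].

Lemma card_cover_graph_cycle G c : graph_cycle G c -> #|cover c| = #|c|.
Proof.
case=> s [Us s3 -> _].
by rewrite cover_cycle_edges card_cycle_edges // cardsE (card_uniqP Us).
Qed.

Lemma graph_cycle_gt2 G c : graph_cycle G c -> 2 < #|cover c|.
Proof.
by case=> s [Us s3 -> _]; rewrite cover_cycle_edges cardsE (card_uniqP Us).
Qed.

Lemma graph_cycle_sub G (G' : {set {set V}}) c :
  graph_cycle G c -> c \subset G' -> graph_cycle G' c.
Proof. by case=> s [? ? ? _] ?; exists s. Qed.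

(** Disjointness of the components and the fact that they span [D] are a single
    partition condition on the vertex sets of the components; injectivity of
    [cover] excludes two distinct cycles on the same vertices. *)
Definition spanning_elementary (D : {set V}) G (C : {set {set {set V}}})
    (E : {set {set V}}) : Prop :=
  [/\ {in C, forall c, graph_cycle G c}, {in C &, injective (@cover V)},
      E \subset G & partition (cover @: C :|: E) D].

(** The left-hand side counts vertices, component by component, and the
    right-hand side is the quantity required to be [q] for an elementary
    [q]-subhypergraph.  They agree because a cycle has as many vertices as
    edges. *)
Lemma sum_card_blocks G (C : {set {set {set V}}}) (E : {set {set V}}) :
    {in C, forall c, graph_cycle G c} -> {in C &, injective (@cover V)} ->
    {in E, forall P : {set V}, #|P| = 2} ->
  \sum_(B in cover @: C :|: E) #|B| = \sum_(c in C) #|c| + 2 * #|E|.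
Proof.
move=> Ccyc Cinj E2; rewrite (eq_bigl [predU cover @: C & E]); last first.
  by move=> P; rewrite !inE.
rewrite bigU /=.
  rewrite big_imset //= mulnC -sum_nat_const; congr (_ + _).
    by apply: eq_bigr => c /Ccyc/card_cover_graph_cycle.
  by apply: eq_bigr => P /E2.
rewrite -setI_eq0; apply/set0Pn=> -[_ /setIP[/imsetP[c cC ->] /E2]].
by have := graph_cycle_gt2 (Ccyc c cC) => + c2; rewrite c2.
Qed.

End CycleEdges.

(** * Orbits of permutations *)

Section PermutationOrbits.

Variable X : finType.
Implicit Types (s t : {perm X}) (x y : X) (p : seq X) (o : {set X}).

Lemma porbit_fcycle s p x : fcycle s p -> x \in p -> porbit s x =i p.
Proof.
move=> cp px y; rewrite -(fconnect_cycle cp px); apply/porbitP/idP.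
  by case=> i ->; rewrite permX fconnect_iter.
by move=> /iter_findex <-; exists (findex s x y); rewrite permX.
Qed.

Lemma fcycle_traject_porbit s x : fcycle s (traject s x #|porbit s x|).
Proof.
have := iter_porbit s x; case: #|_| => //= n Ex.
suff ->: rcons (traject s (s x) n) x = traject s (s x) n.+1.
  exact: fpath_traject.
by rewrite trajectSr -iterSr iterS Ex.
Qed.

Lemma mem_porbit1 s x : s x \in porbit s x.
Proof. by have := mem_porbit s 1 x; rewrite expg1. Qed.

Lemma porbits_eq s o x : o \in porbits s -> x \in o -> o = porbit s x.
Proof.
by case/imsetP=> y _ -> xy; apply/esym/eqP; rewrite eq_porbit_mem.
Qed.

Lemma porbits_stable s o x : o \in porbits s -> x \in o -> s x \in o.
Proof. by move=> os /(porbits_eq os)->; apply: mem_porbit1. Qed.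

Lemma porbit_in_porbits s x : porbit s x \in porbits s.
Proof. exact: imset_f. Qed.

Lemma partition_porbits s : partition (porbits s) [set: X].
Proof.
apply/and3P; split.
- apply/eqP/setP=> x; rewrite inE; apply/bigcupP.
  by exists (porbit s x); rewrite ?porbit_in_porbits ?porbit_id.
- apply/trivIsetP=> o1 o2 o1s o2s; apply: contraR.
  rewrite -setI_eq0 => /set0Pn[x]; rewrite inE => /andP[x1 x2].
  by rewrite (porbits_eq o1s x1) (porbits_eq o2s x2).
- by apply/imsetP=> -[x _ E]; have := porbit_id s x; rewrite -E inE.
Qed.

Lemma porbit2 s x : s (s x) = x -> porbit s x = [set x; s x].
Proof.
move=> E; have cs: fcycle s [:: x; s x] by rewrite /= E !eqxx.
by apply/setP=> y; rewrite (porbit_fcycle cs) ?mem_head // !inE.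
Qed.

Lemma porbit_gt2 s x : s x != x -> (2 < #|porbit s x|) = (s (s x) != x).
Proof.
move=> sx; have [E|ssx] := eqVneq.
  by rewrite porbit2 // cards2 eq_sym sx.
have /subset_leq_card: [set x; s x; s (s x)] \subset porbit s x.
  apply/subsetP=> y; rewrite !inE -orbA => /or3P[] /eqP->.
  - exact: porbit_id.
  - exact: mem_porbit1.
  - by rewrite -(porbit_perm s 1 x) expg1 mem_porbit1.
apply: leq_trans; rewrite -setUA cardsU1 cards2 !inE.
by rewrite (inj_eq perm_inj) !(eq_sym x) (negPf sx) (negPf ssx).
Qed.

Lemma eq_in_porbit s t x :
  {in porbit s x, t =1 s} -> porbit t x = porbit s x.
Proof.
move=> E; have Ei i : (t ^+ i)%g x = (s ^+ i)%g x.
  by elim: i => [|i IH]; rewrite ?expg0 // !expgSr !permM IH E ?mem_porbit.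
by apply/setP=> y; apply/porbitP/porbitP=> -[i ->]; exists i; rewrite Ei.
Qed.

Definition deranged s : bool := [forall x, s x != x].

Definition long_porbits s : {set {set X}} := [set o in porbits s | 2 < #|o|].

Lemma mem_long_porbits s x :
  (porbit s x \in long_porbits s) = (2 < #|porbit s x|).
Proof. by rewrite inE porbit_in_porbits. Qed.

Lemma short_porbit s x :
  deranged s -> porbit s x \notin long_porbits s -> porbit s x = [set x; s x].
Proof.
move=> /forallP ds; rewrite mem_long_porbits porbit_gt2 // negbK => /eqP.
exact: porbit2.
Qed.

End PermutationOrbits.

(** * The cycles and the matching of a permutation *)

(** The points permuted are embedded by [v] into the vertices of the graph, so
    that permutations of ordinals can describe subgraphs on other types. *)
Section PermutationDecomposition.

Variables (X V : finType) (v : X -> V).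
Hypothesis v_inj : injective v.
Implicit Types (s t : {perm X}) (x y : X) (p : seq X) (o : {set X}).

Definition porbit_edges s o : {set {set V}} :=
  [set [set v x; v (s x)] | x in o].

Definition perm_cycles s : {set {set {set V}}} :=
  porbit_edges s @: long_porbits s.

(** Without fixed points, an orbit that is not long is itself an unordered
    pair. *)
Definition perm_matching s : {set {set V}} :=
  [set v @: (o : {set X}) | o in porbits s :\: long_porbits s].

Definition perm_edges s : {set {set V}} := porbit_edges s [set: X].

Lemma vset2_eq x y a b : [set v x; v y] = [set v a; v b] ->
  (x = a /\ y = b) \/ (x = b /\ y = a).
Proof. by case/set2_eq=> -[/v_inj-> /v_inj->]; [left|right]. Qed.

Lemma perm_edgesP s x y :
  reflect (s x = y \/ s y = x) ([set v x; v y] \in perm_edges s).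
Proof.
apply: (iffP imsetP) => [[z _ /vset2_eq[][-> ->]]|[<-|<-]]; auto.
  by exists x.
by exists y; rewrite // setUC.
Qed.

Lemma cover_porbit_edges s o :
  o \in porbits s -> cover (porbit_edges s o) = v @: o.
Proof.
move=> os; apply/setP=> S; apply/bigcupP/imsetP.
  case=> _ /imsetP[x xo ->]; rewrite !inE => /orP[] /eqP->; first by exists x.
  by exists (s x); rewrite // (porbits_stable os).
case=> x xo ->; exists [set v x; v (s x)]; rewrite ?set21 //.
by apply/imsetP; exists x.
Qed.

Lemma porbit_edges_inj s : {in porbits s &, injective (porbit_edges s)}.
Proof.
move=> o1 o2 o1s o2s /(congr1 (@cover V)).
by rewrite !cover_porbit_edges //; apply: (imset_inj v_inj).
Qed.

Lemma long_porbits_sub s : long_porbits s \subset porbits s.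
Proof. by apply/subsetP=> o; rewrite inE => /andP[]. Qed.

Lemma card_perm_cycles s : #|perm_cycles s| = #|long_porbits s|.
Proof.
rewrite card_in_imset // => o1 o2 /(subsetP (long_porbits_sub s)) o1s.
by move=> /(subsetP (long_porbits_sub s)); apply: porbit_edges_inj.
Qed.

Lemma card_porbits s : #|porbits s| = #|perm_cycles s| + #|perm_matching s|.
Proof.
rewrite card_perm_cycles [#|perm_matching s|]card_imset; last exact: imset_inj.
by rewrite -(cardsID (long_porbits s) (porbits s))
           (setIidPr (long_porbits_sub s)).
Qed.

Lemma perm_blocks s :
  cover @: perm_cycles s :|: perm_matching s =
  [set v @: (o : {set X}) | o in porbits s].
Proof.
rewrite -imset_comp (eq_in_imset (g := fun o : {set X} => v @: o)).
  rewrite -imsetU -{1}(setIidPr (long_porbits_sub s)) setID //.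
by move=> o /(subsetP (long_porbits_sub s)) /=; apply: cover_porbit_edges.
Qed.

Lemma perm_edgesE s :
  deranged s -> perm_edges s = cover (perm_cycles s) :|: perm_matching s.
Proof.
move=> ds; apply/setP=> P; apply/imsetP/setUP.
  case=> x _ ->; case: (boolP (porbit s x \in long_porbits s)) => [lx|sx].
    left; apply/bigcupP; exists (porbit_edges s (porbit s x)).
      exact: imset_f.
    by apply/imsetP; exists x; rewrite ?porbit_id.
  right; apply/imsetP; exists (porbit s x).
    by rewrite in_setD sx porbit_in_porbits.
  by rewrite short_porbit // imsetU !imset_set1.
case=> [/bigcupP[_ /imsetP[o _ ->] /imsetP[x _ ->]]|/imsetP[o]].
  by exists x.
rewrite in_setD => /andP[so /imsetP[x _ Eo]] ->; rewrite {}Eo in so *.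
by exists x; rewrite // short_porbit // imsetU !imset_set1.
Qed.


(** Two permutations with the same unoriented edges agree, or are inverse to
    each other, at every single point; the next lemmas show that the choice is
    constant along each orbit. *)
Lemma perm_edges_agree_or_inv s t x :
  perm_edges t = perm_edges s -> t x = s x \/ s (t x) = x.
Proof.
move=> E; have: [set v x; v (t x)] \in perm_edges t.
  by apply/perm_edgesP; left.
by rewrite E => /perm_edgesP[]; auto.
Qed.

(** Otherwise [t] would swap [x] and [s x].  Then [x] would have no other
    neighbour, so the edge from the [s]-predecessor of [x] to [x] would be
    this same edge, and [s] would swap [x] and [s x] as well. *)
Lemma perm_edges_agreeS s t x :
  perm_edges t = perm_edges s -> t x = s x -> t (s x) = s (s x).
Proof.
move=> E Ex; case: (perm_edges_agree_or_inv (s x) E) => // /perm_inj tsx.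
set z := (s^-1)%g x.
have sz: s z = x by rewrite permKV.
have: [set v z; v x] \in perm_edges s by apply/perm_edgesP; left.
rewrite -E => /perm_edgesP[tz|tx].
  have: z = s x by apply: (@perm_inj _ t); rewrite tz tsx.
  by move=> <-; rewrite sz -tz.
by rewrite tsx -Ex tx sz.
Qed.

Lemma perm_edges_agree_porbit s t x :
  perm_edges t = perm_edges s -> t x = s x -> {in porbit s x, t =1 s}.
Proof.
move=> E Ex _ /porbitP[i ->]; elim: i => [|i IH]; first by rewrite expg0 perm1.
by rewrite expgSr permM perm_edges_agreeS.
Qed.

Definition reverse_fun s (D : {set {set X}}) x : X :=
  if porbit s x \in D then (s^-1)%g x else s x.

Lemma porbit_permV s x : porbit s ((s^-1)%g x) = porbit s x.
Proof. by rewrite -!(porbitV s) -[RHS](porbit_perm s^-1 1 x) expg1. Qed.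

Lemma porbit_reverse_fun s D x : porbit s (reverse_fun s D x) = porbit s x.
Proof.
rewrite /reverse_fun; case: ifP => _; first exact: porbit_permV.
by rewrite -[RHS](porbit_perm s 1 x) expg1.
Qed.

(** Injectivity holds because both branches stay in the orbit of [s] through the
    argument, so two points with the same image fall in the same branch. *)
Lemma reverse_fun_inj s D : injective (reverse_fun s D).
Proof.
move=> x y E; have := congr1 (porbit s) E; rewrite !porbit_reverse_fun => Eo.
by move: E; rewrite /reverse_fun Eo; case: ifP => _; apply: perm_inj.
Qed.

Definition reverse_porbits s D : {perm X} := perm (@reverse_fun_inj s D).

Lemma reverse_porbitsE s D x :
  reverse_porbits s D x = if porbit s x \in D then (s^-1)%g x else s x.
Proof. by rewrite permE. Qed.

Lemma porbit_reverse s D : porbit (reverse_porbits s D) =1 porbit s.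
Proof.
move=> x; case: (boolP (porbit s x \in D)) => xD.
  rewrite -(porbitV s); apply: eq_in_porbit => y; rewrite porbitV.
  by rewrite -eq_porbit_mem reverse_porbitsE => /eqP->; rewrite xD.
apply: eq_in_porbit => y.
by rewrite -eq_porbit_mem reverse_porbitsE => /eqP->; rewrite (negPf xD).
Qed.

Lemma porbits_reverse s D : porbits (reverse_porbits s D) = porbits s.
Proof. exact/eq_imset/porbit_reverse. Qed.

Lemma long_porbits_reverse s D :
  long_porbits (reverse_porbits s D) = long_porbits s.
Proof. by rewrite /long_porbits porbits_reverse. Qed.

Lemma porbit_edges_reverse s D o :
  o \in porbits s -> porbit_edges (reverse_porbits s D) o = porbit_edges s o.
Proof.
move=> os; case: (boolP (o \in D)) => oD; last first.
  apply: eq_in_imset => x /(porbits_eq os) Eo.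
  by rewrite reverse_porbitsE -Eo (negPf oD).
apply/setP=> P; apply/imsetP/imsetP=> -[x xo ->].
  exists ((s^-1)%g x); last first.
    by rewrite reverse_porbitsE -(porbits_eq os xo) oD permKV setUC.
  by rewrite (porbits_eq os xo) -eq_porbit_mem porbit_permV.
have sxo := porbits_stable os xo.
exists (s x) => //.
by rewrite reverse_porbitsE -(porbits_eq os sxo) oD permK setUC.
Qed.

Lemma perm_cycles_reverse s D :
  perm_cycles (reverse_porbits s D) = perm_cycles s.
Proof.
rewrite /perm_cycles long_porbits_reverse; apply: eq_in_imset => o.
by move=> /(subsetP (long_porbits_sub s)); apply: porbit_edges_reverse.
Qed.

Lemma perm_matching_reverse s D :
  perm_matching (reverse_porbits s D) = perm_matching s.
Proof. by rewrite /perm_matching porbits_reverse long_porbits_reverse. Qed.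

Lemma deranged_reverse s D : deranged s -> deranged (reverse_porbits s D).
Proof.
move=> /forallP ds; apply/forallP=> x; rewrite reverse_porbitsE.
case: ifP => // _.
by rewrite -{2}(permKV s x) eq_sym.
Qed.

(** An orbit of length at least 3 can be traversed in two different directions,
    so reversing it is visible at each of its points. *)
Lemma reverse_porbits_inj s :
  deranged s -> {in powerset (long_porbits s) &, injective (reverse_porbits s)}.
Proof.
move=> /forallP ds.
suff sub (D D' : {set {set X}}) : D \subset long_porbits s ->
    reverse_porbits s D = reverse_porbits s D' -> D \subset D'.
  move=> D D'; rewrite !powersetE => DL D'L E.
  by apply/eqP; rewrite eqEsubset; apply/andP; split; exact: sub.
move=> DL E; apply/subsetP=> o oD.
have := subsetP DL _ oD; rewrite inE => /andP[/imsetP[x _ Eo] o3].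
move/permP/(_ x): E; rewrite !reverse_porbitsE -Eo oD.
case: ifP => // _ E; move: o3; rewrite Eo porbit_gt2 //.
by rewrite -E permKV eqxx.
Qed.

(** Given [t] in the fiber, the long orbits to reverse are those on which [t] is
    everywhere the inverse of [s]; on any other long orbit [t] agrees with [s]
    at one point, hence at all.  On orbits of length 2 both choices coincide. *)
Lemma fiber_perm_decomposition s : deranged s ->
  [set t | [&& deranged t, perm_cycles t == perm_cycles s
             & perm_matching t == perm_matching s]] =
  reverse_porbits s @: powerset (long_porbits s).
Proof.
move=> ds; apply/setP=> t; rewrite inE; apply/and3P/imsetP; last first.
  case=> D _ ->; rewrite perm_cycles_reverse perm_matching_reverse.
  by rewrite deranged_reverse.
case=> dt /eqP Ec /eqP Em.
have E: perm_edges t = perm_edges s by rewrite !perm_edgesE // Ec Em.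
pose D := [set o in long_porbits s | [forall x in o, t x == (s^-1)%g x]].
exists D; first by rewrite powersetE; apply/subsetP=> o; rewrite inE => /andP[].
have tV y : s (t y) = y -> t y = (s^-1)%g y by move=> Ey; rewrite -{2}Ey permK.
apply/permP=> x; rewrite reverse_porbitsE.
case: ifP.
  by rewrite inE => /andP[_ /forall_inP tx]; apply/eqP/tx/porbit_id.
rewrite inE => /negbT; rewrite negb_and => /orP[sx|].
  case: (perm_edges_agree_or_inv x E) => // /tV->.
  have /eqP := porbit_permV s x; rewrite eq_porbit_mem short_porbit //.
  rewrite !inE => /orP[/eqP Ex|/eqP//].
  by have /forallP/(_ x) := ds; rewrite -{1}Ex permKV eqxx.
rewrite negb_forall_in => /exists_inP[y yx ty].
have Exy: porbit s x = porbit s y by apply/esym/eqP; rewrite eq_porbit_mem.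
case: (perm_edges_agree_or_inv y E) => [Ey|/tV Ey]; last first.
  by rewrite Ey eqxx in ty.
by apply: (perm_edges_agree_porbit E Ey); rewrite -Exy porbit_id.
Qed.

Lemma card_fiber_perm_decomposition s : deranged s ->
  #|[set t | [&& deranged t, perm_cycles t == perm_cycles s
             & perm_matching t == perm_matching s]]| = 2 ^ #|perm_cycles s|.
Proof.
move=> ds; rewrite fiber_perm_decomposition // card_in_imset.
  by rewrite card_powerset card_perm_cycles.
exact: reverse_porbits_inj.
Qed.

Lemma spanning_elementary_perm (G : {set {set V}}) s :
    deranged s -> perm_edges s \subset G ->
  spanning_elementary (v @: [set: X]) G (perm_cycles s) (perm_matching s).
Proof.
move=> ds; rewrite perm_edgesE // subUset => /andP[sCG sEG]; split=> //.
- move=> _ /imsetP[o lo ->]; have := lo.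
  rewrite inE => /andP[/imsetP[x _ Eo] o3].
  set p := traject s x #|porbit s x|.
  have Up: uniq p by exact: uniq_traject_porbit.
  exists (map v p); split.
  + by rewrite map_inj_uniq.
  + by rewrite size_map size_traject -Eo.
  + rewrite Eo; apply/setP=> P; apply/imsetP/imsetP.
      case=> y; rewrite porbit_traject => yp ->.
      exists (v y); first by rewrite map_f.
      by rewrite next_map // (nextE (fcycle_traject_porbit s x)).
    case=> _ /mapP[y yp ->] ->; exists y; first by rewrite porbit_traject.
    by rewrite next_map // (nextE (fcycle_traject_porbit s x)).
  + apply: subset_trans sCG; apply: (bigcup_max (porbit_edges s o)) => //.
    exact: imset_f.
- move=> _ _ /imsetP[o1 l1 ->] /imsetP[o2 l2 ->].
  have o1s := subsetP (long_porbits_sub s) _ l1.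
  have o2s := subsetP (long_porbits_sub s) _ l2.
  by rewrite !cover_porbit_edges // => /(imset_inj v_inj)->.
- rewrite perm_blocks; have /and3P[/eqP c tr s0] := partition_porbits s.
  apply/and3P; split.
  + by rewrite cover_imset -c imset_cover.
  + apply/trivIsetP=> _ _ /imsetP[o1 o1s ->] /imsetP[o2 o2s ->] n12.
    have n: o1 != o2 by apply: contraNneq n12 => ->.
    by rewrite imset_disjoint ?(trivIsetP tr).
  + apply/imsetP=> -[o os /esym/eqP]; rewrite imset_eq0 => /eqP o0.
    by rewrite -o0 os in s0.
Qed.

(** A cyclic ordering of each component is chosen, any direction for a cycle and
    either order for an edge; the permutation sends each point to its successor
    in the component that contains it. *)
Lemma exists_perm_cycles_matching (G : {set {set V}}) C E :
    {in G, forall P : {set V}, #|P| = 2} ->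
    spanning_elementary (v @: [set: X]) G C E ->
  exists s, [/\ deranged s, perm_cycles s = C & perm_matching s = E].
Proof.
move=> G2 [Ccyc Cinj EG Bpart]; set B := _ :|: _ in Bpart.
have /and3P[/eqP Bcov Btriv B0] := Bpart.
have Bsub b : b \in B -> b \subset v @: [set: X].
  by move=> bB; rewrite -Bcov; apply: (bigcup_max b).
have pullback (p : seq V) :
    {subset p <= v @: [set: X]} -> exists q, p = map v q.
  elim: p => [|S p IH] sp; first by exists [::].
  have /imsetP[x _ ->] := sp S (mem_head _ _).
  have [|q ->] := IH; last by exists (x :: q).
  by move=> y yp; apply: sp; rewrite inE yp orbT.
have /fin_all_exists[q qP] : forall b : {set V}, exists q : seq X, b \in B ->
    [/\ uniq q, b = v @: [set x in q]
      & 2 < size q /\ cycle_edges (map v q) \in C \/ size q = 2 /\ b \in E].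
  move=> b; case: (boolP (b \in B)) => bB; last by exists [::].
  have bX := Bsub b bB; case/setUP: bB => [/imsetP[c cC Eb]|bE].
    have [p [Up p3 Ec _]] := Ccyc c cC.
    have Ebp: b = [set S in p] by rewrite Eb Ec cover_cycle_edges.
    have [S Sp|q Eq] := pullback p.
      by apply: (subsetP bX); rewrite Ebp inE.
    exists q => _; split.
    - by rewrite -(map_inj_uniq v_inj) -Eq.
    - rewrite Ebp Eq; apply/setP=> S; rewrite inE.
      apply/mapP/imsetP=> -[x xq ->];
        by exists x; rewrite // inE in xq *.
    - by left; rewrite -(size_map v) -Eq -Ec.
  have /eqP/cards2P[S [S' [nS Eb]]] := G2 b (subsetP EG b bE).
  have [y|q Eq] := pullback [:: S; S'].
    by rewrite !inE => yb; apply: (subsetP bX); rewrite Eb !inE.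
  exists q => _; split.
  - by rewrite -(map_inj_uniq v_inj) -Eq /= inE nS.
  - apply/setP=> y; transitivity (y \in [:: S; S']); first by rewrite Eb !inE.
    rewrite Eq; apply/mapP/imsetP=> -[x xq ->];
      by exists x; rewrite // inE in xq *.
  - by right; rewrite -(size_map v) -Eq.
pose blk x := pblock B (v x).
have vB x : v x \in cover B by rewrite Bcov imset_f.
have blkB x : blk x \in B by apply: pblock_mem.
have blk_q x : x \in q (blk x).
  have: v x \in blk x by rewrite mem_pblock.
  have [_ Eb _] := qP _ (blkB x).
  by rewrite {1}Eb mem_imset // inE.
have q_blk x b : b \in B -> x \in q b -> blk x = b.
  move=> bB xq; apply: def_pblock => //.
  by have [_ -> _] := qP b bB; rewrite mem_imset // inE.
pose f x := next (q (blk x)) x.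
have f_blk x : blk (f x) = blk x by apply: q_blk; rewrite ?mem_next.
have f_inj : injective f.
  move=> x y Exy; have Eb: blk x = blk y by rewrite -f_blk Exy f_blk.
  have [Uq _ _] := qP _ (blkB y).
  by move: Exy; rewrite /f Eb => /(can_inj (prev_next Uq)).
pose s := perm f_inj.
have q_cyc b : b \in B -> fcycle s (q b).
  move=> bB; have [Uq _ _] := qP b bB; apply: cycle_from_next => // x xq.
  by rewrite /= permE /f (q_blk x b).
have s_orb x : porbit s x =i q (blk x) by apply: porbit_fcycle; rewrite ?q_cyc.
have v_orb x : v @: porbit s x = blk x.
  have [_ Eb _] := qP _ (blkB x); rewrite [RHS]Eb.
  suff ->: porbit s x = [set y in q (blk x)] by [].
  by apply/setP=> y; rewrite s_orb [RHS]inE.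
have card_orb x : #|porbit s x| = size (q (blk x)).
  have [Uq _ _] := qP _ (blkB x).
  by rewrite (eq_card (s_orb x)) (card_uniqP Uq).
have orb_edges x :
    porbit_edges s (porbit s x) = cycle_edges (map v (q (blk x))).
  have [Uq _ _] := qP _ (blkB x); have cq := q_cyc _ (blkB x).
  apply/setP=> P; apply/imsetP/imsetP.
    case=> y; rewrite s_orb => yq ->; exists (v y); first by rewrite map_f.
    by rewrite next_map // (nextE cq).
  case=> _ /mapP[y yq ->] ->; exists y; first by rewrite s_orb.
  by rewrite next_map // (nextE cq).
have blk_ex b : b \in B -> exists x, b = blk x.
  move=> bB; have /set0Pn[S Sb] : b != set0.
    by apply: contraNneq B0 => <-.
  have /imsetP[x _ ES] := subsetP (Bsub b bB) S Sb.
  by exists x; apply/esym/def_pblock; rewrite -?ES.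
exists s; split.
- apply/forallP=> x; apply/eqP=> sx.
  have : #|porbit s x| <= 1.
    by rewrite porbit2 ?sx // setUid cards1.
  rewrite card_orb; have [_ _ [[q3 _]|[-> _]]] := qP _ (blkB x) => //.
  by rewrite leqNgt (ltnW q3).
- apply/setP=> c; apply/imsetP/idP.
    case=> o; rewrite inE => /andP[/imsetP[x _ ->]]; rewrite card_orb => q3 ->.
    rewrite orb_edges; have [_ _ [[//]|[q2 _]]] := qP _ (blkB x).
    by rewrite q2 in q3.
  move=> cC; have [|x Ex] := blk_ex (cover c); first by rewrite inE imset_f.
  have [_ Eq [[q3 qC]|[q2 _]]] := qP _ (blkB x).
    exists (porbit s x); first by rewrite mem_long_porbits card_orb.
    apply: Cinj; rewrite ?orb_edges //.
    by rewrite -orb_edges cover_porbit_edges ?porbit_in_porbits // v_orb.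
  have := graph_cycle_gt2 (Ccyc c cC).
  by rewrite Ex -v_orb card_imset // card_orb q2.
- apply/setP=> P; apply/imsetP/idP.
    case=> o; rewrite in_setD => /andP[so /imsetP[x _ Eo]] ->.
    move: so; rewrite Eo mem_long_porbits card_orb v_orb.
    by have [_ _ [[->]|[]]] := qP _ (blkB x).
  move=> PE; have [|x Ex] := blk_ex P; first by rewrite inE PE orbT.
  exists (porbit s x); last by rewrite v_orb.
  rewrite in_setD porbit_in_porbits mem_long_porbits andbT -leqNgt.
  by rewrite -(card_imset _ v_inj) v_orb -Ex G2 // (subsetP EG).
Qed.

Lemma perm_edges_sub_deranged (G : {set {set V}}) s :
  {in G, forall P : {set V}, #|P| = 2} -> perm_edges s \subset G -> deranged s.
Proof.
move=> G2 sG; apply/forallP=> x; apply/eqP=> sx.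
have /(subsetP sG)/G2: [set v x; v (s x)] \in perm_edges s.
  by apply/perm_edgesP; left.
by rewrite sx setUid cards1.
Qed.

Lemma odd_perm_decomposition s : deranged s ->
  odd_perm s = odd (#|X| - #|perm_cycles s| - #|perm_matching s|).
Proof.
move=> ds; rewrite -subnDA -card_porbits oddB //.
exact: leq_imset_card.
Qed.

End PermutationDecomposition.

(** * The Harary-Sachs formula *)

Section Determinant.

Import GRing.Theory.
Local Open Scope ring_scope.

Theorem harary_sachs (R : comNzRingType) (V : finType) (n : nat)
    (v : 'I_n -> V) (G : {set {set V}}) :
    injective v -> {in G, forall P : {set V}, #|P| = 2%N} ->
  \det (\matrix_(i, j) ([set v i; v j] \in G)%:R : 'M[R]_n) =
  \sum_(p | `[< spanning_elementary (v @: [set: 'I_n]) G p.1 p.2 >])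
     (-1) ^+ (n - #|p.1| - #|p.2|)%N * 2 ^+ #|p.1|.
Proof.
move=> v_inj G2.
pose dec (s : 'S_n) := (perm_cycles v s, perm_matching v s).
have dG s := @perm_edges_sub_deranged _ _ v v_inj G s G2.
transitivity (\sum_(s : 'S_n | perm_edges v s \subset G) (-1) ^+ s : R).
  rewrite /determinant [RHS]big_mkcond; apply: eq_bigr => s _.
  case: ifP => [sG|/negbT/subsetPn[P /imsetP[x _ ->] nG]].
    rewrite big1 ?mulr1 // => i _; rewrite mxE (subsetP sG) //.
    by apply/imsetP; exists i.
  by rewrite (bigD1 x) //= mxE (negPf nG) mul0r mulr0.
(* The permutations are grouped by the subgraph that they determine. *)
rewrite (partition_big dec
  (fun p => `[< spanning_elementary (v @: [set: 'I_n]) G p.1 p.2 >]));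
  last first.
  by move=> s sG; apply/asboolP/spanning_elementary_perm => //; apply: dG.
apply: eq_bigr => -[C E] /asboolP /= CE.
have [s0 [ds0 EC EE]] := exists_perm_cycles_matching v_inj G2 CE.
pose fiber := [set t | [&& deranged t, perm_cycles v t == perm_cycles v s0
                         & perm_matching v t == perm_matching v s0]].
rewrite (eq_bigl (mem fiber)); last first.
  (* Having edges in [G] depends only on the cycles and the matching. *)
  move=> s; rewrite /= inE /dec xpair_eqE EC EE.
  case: eqP => [Ec|]; rewrite ?andbF //.
  case: eqP => [Em|]; rewrite ?andbF // !andbT.
  apply/idP/idP=> [/dG//|ds]; rewrite perm_edgesE // Ec Em.
  have [Ccyc _ EG _] := CE; rewrite subUset EG andbT.
  by apply/bigcupsP=> c /Ccyc[p []].
transitivity (\sum_(s in fiber) (-1) ^+ (n - #|C| - #|E|)%N : R).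
  apply: eq_bigr => s; rewrite !inE => /and3P[ds /eqP Ec /eqP Em].
  by rewrite (odd_perm_decomposition v_inj) // signr_odd card_ord Ec Em EC EE.
rewrite sumr_const -[LHS]mulr_natr -natrX; congr (_ * _%:R).
rewrite -EC -(card_fiber_perm_decomposition v_inj ds0); apply: eq_card => s.
by rewrite !inE.
Qed.

End Determinant.

(** * The graph of 2-partitions of a hypergraph *)

Section UnifiedGraph.

Variable T : finType.
Implicit Types (H : simple_hypergraph T) (e S : {set T}) (P : {set {set T}}).
Implicit Types (c E : {set {set {set T}}}) (C : {set {set {set {set T}}}}).

Lemma two_partitionsP e P :
  reflect (exists S S', [/\ S != set0, S' != set0, [disjoint S & S'],
                            P = [set S; S'] & e = S :|: S'])
          (P \in two_partitions e).
Proof.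
rewrite inE; apply: (iffP andP) => [[/and3P[/eqP cP tP P0]]|].
  case/cards2P=> S [S' [nS EP]]; exists S, S'; split=> //.
  - by apply: contraNneq P0 => <-; rewrite EP set21.
  - by apply: contraNneq P0 => <-; rewrite EP set22.
  - by apply: (trivIsetP tP); rewrite // EP ?set21 ?set22.
  - by rewrite -cP EP /cover bigcup_setU !big_set1.
case=> S [S' [S0 S'0 dS -> ->]].
have nS: S != S'.
  by apply: contraNneq S0 => E; move: dS; rewrite -E -setI_eq0 setIid.
rewrite cards2 nS; split=> //; apply/and3P; split.
- by rewrite /cover bigcup_setU !big_set1.
- apply/trivIsetP=> A B; rewrite !inE.
  case/orP=> /eqP-> /orP[] /eqP->; rewrite ?eqxx //.
  by rewrite disjoint_sym.
- by rewrite !inE !(eq_sym set0) negb_or S0.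
Qed.

Lemma cover_two_partitions e P : P \in two_partitions e -> cover P = e.
Proof. by rewrite inE => /andP[/and3P[/eqP]]. Qed.

Lemma card_two_partitions e P : P \in two_partitions e -> #|P| = 2.
Proof. by rewrite inE => /andP[_ /eqP]. Qed.

Definition unified_graph H : {set {set {set T}}} :=
  \bigcup_(e in edges H) two_partitions e.

Lemma unified_graphP H P : reflect
  (cover P \in edges H /\ P \in two_partitions (cover P))
  (P \in unified_graph H).
Proof.
apply: (iffP bigcupP) => [[e eH Pe]|[]].
  by rewrite (cover_two_partitions Pe).
by exists (cover P).
Qed.

Lemma card_unified_graph H : {in unified_graph H, forall P, #|P| = 2}.
Proof. by move=> P /bigcupP[e _ /card_two_partitions]. Qed.

Lemma cover_unified_graph H : cover (unified_graph H) \subset index_set H.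
Proof.
apply/subsetP=> S /bigcupP[P /bigcupP[e eH Pe] SP]; rewrite inE.
by apply/orP; left; apply/bigcupP; exists e => //; apply/bigcupP; exists P.
Qed.

(** Two edges are not enough: consecutive edges of the walk differ, since a part
    and the edge determine the next part.  With only two edges available each
    part would therefore lie in both of them; both edges, being unions of parts,
    would then be equal. *)
Lemma card_cycle_edge_covers H (s : seq {set T}) :
    uniq s -> 2 < size s -> cycle_edges s \subset unified_graph H ->
  2 < size (undup [seq A :|: next s A | A <- s]).
Proof.
move=> Us s3 sG; set e := fun A => A :|: next s A.
have dis S : S \in s ->
    [/\ S != set0, next s S != set0 & [disjoint S & next s S]].
  move=> Ss.
  have /(subsetP sG)/bigcupP[f _]: [set S; next s S] \in cycle_edges s.
    exact: (imset_f (fun A => [set A; next s A])).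
  case/two_partitionsP=> A [A' [A0 A'0 dA EA _]].
  by case/set2_eq: EA => -[-> ->]; rewrite // disjoint_sym.
have e_next S : S \in s -> e S != e (next s S).
  move=> Ss; have [_ _ d1] := dis S Ss.
  have nSs: next s S \in s by rewrite mem_next.
  have [_ _ d2] := dis _ nSs.
  apply: contraNneq (next_next_neq Us s3 Ss) => E.
  have: e S :\: next s S = e (next s S) :\: next s S by rewrite E.
  rewrite /e setDUl setDv setU0 (setDidPl d1) setDUl setDv set0U.
  by rewrite (setDidPl _) 1?disjoint_sym // => <-.
rewrite ltnNge; apply/negP=> le2.
have [S Ss] : exists S, S \in s.
  by exists (nth set0 s 0); apply: mem_nth; apply: leq_trans s3.
have nSs: next s S \in s by rewrite mem_next.
(* Two consecutive edges are distinct, so they exhaust the list. *)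
have two: [seq A :|: next s A | A <- s] =i [:: e S; e (next s S)].
  have U2: uniq [:: e S; e (next s S)] by rewrite /= inE e_next.
  have sub2: {subset [:: e S; e (next s S)] <= undup [seq e A | A <- s]}.
    by move=> g; rewrite !inE mem_undup => /orP[] /eqP->; apply: map_f.
  have [_ eq2] := uniq_min_size U2 sub2 le2.
  by move=> f; rewrite eq2 mem_undup.
have sub A : A \in s -> A \subset e S /\ A \subset e (next s S).
  move=> As; have pAs : prev s A \in s by rewrite mem_prev.
  have := e_next _ pAs; rewrite next_prev //.
  have: e A \in [:: e S; e (next s S)] by rewrite -two; apply: (map_f e).
  have: e (prev s A) \in [:: e S; e (next s S)].
    by rewrite -two; apply: (map_f e).
  have Ae : A \subset e A by apply: subsetUl.
  have Ae' : A \subset e (prev s A) by rewrite /e next_prev // subsetUr.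
  rewrite !inE => /orP[] /eqP E1 /orP[] /eqP E2;
    rewrite -?E1 -?E2 ?E1 ?E2 ?eqxx // => _.
  - by rewrite -E1 -E2.
  - by rewrite -E1 -E2.
have /eqP[] := e_next S Ss; apply/eqP; rewrite eqEsubset.
have nnSs: next s (next s S) \in s by rewrite mem_next.
have [_ s1] := sub _ Ss; have [s2 s2'] := sub _ nSs; have [s3' _] := sub _ nnSs.
by rewrite {1}/e subUset s1 s2' {2}/e subUset s2 s3'.
Qed.

(** The hypergraph edge of each step is recovered as the union of the two parts,
    which is why the edges of a walk need not be recorded in a graph cycle. *)
Lemma exact_cycleP H c : exact_cycle H c <-> graph_cycle (unified_graph H) c.
Proof.
split=> [/asboolP[S0 [w [/and4P[]]]]|].
  rewrite /exact_walk /traversed => walk /eqP Elast Uw w3 ->.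
  have sw3: 2 < size (unzip2 w).
    rewrite size_map -(size_map fst w); exact: leq_trans w3 (size_undup _).
  case/lastP: (unzip2 w) Elast Uw sw3 walk => // p A.
  rewrite last_rcons => -> Up p3; rewrite rcons_uniq in Up.
  rewrite pairmap_next // => walk.
  exists (S0 :: p); split=> //.
  - by rewrite size_rcons in p3.
  - apply/setP=> P; rewrite inE; apply/mapP/imsetP=> -[B Bp ->]; by exists B.
  - apply/subsetP=> P; rewrite inE => /(all2_exists walk)[e /andP[eH Pe]].
    by apply/bigcupP; exists e.
case=> -[|S0 p] [] // Up p3 Ec sG; rewrite {c}Ec in sG *.
set s := S0 :: p in Up p3 sG *.
pose w := [seq (A :|: next s A, next s A) | A <- s].
have Ew2: unzip2 w = rcons p S0.
  have snd_pairmap (x : {set T}) t : pairmap (fun _ y => y) x t = t.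
    by elim: t x => //= y t IH x; rewrite IH.
  rewrite -[RHS](snd_pairmap S0) pairmap_next //.
  by rewrite /unzip2 -map_comp.
have Ew1: unzip1 w = [seq A :|: next s A | A <- s] by rewrite /unzip1 -map_comp.
have Etr: traversed S0 w = [seq [set A; next s A] | A <- s].
  by rewrite /traversed Ew2 pairmap_next.
apply/asboolP; exists S0, w; split; last first.
  rewrite Etr; apply/setP=> P; rewrite inE.
  by apply/imsetP/mapP=> -[B Bp ->]; exists B.
apply/and4P; split.
- have all2_map (f : {set T} -> {set T}) g r (t : seq {set T}) :
      all2 r (map f t) (map g t) = all (fun A => r (f A) (g A)) t :> bool.
    by elim: t => //= A t ->.
  rewrite /exact_walk Etr Ew1 all2_map; apply/allP=> A As.
  have /(subsetP sG)/unified_graphP: [set A; next s A] \in cycle_edges s.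
    exact: (imset_f (fun A => [set A; next s A])).
  rewrite /cover bigcup_setU !big_set1 => -[-> ->] //.
- by rewrite Ew2 last_rcons.
- by rewrite Ew2 rcons_uniq.
- by rewrite Ew1 (@card_cycle_edge_covers H).
Qed.

Lemma unified_graph_sub H' H :
  edges H' \subset edges H -> unified_graph H' \subset unified_graph H.
Proof.
move=> sE; apply/subsetP=> P /unified_graphP[PH' Pt].
by apply/unified_graphP; rewrite (subsetP sE).
Qed.

(** Condition (iii) together with the disjointness of the cycles makes the
    components pairwise disjoint.  They cover the index set because their sizes
    add up to its cardinality. *)
Lemma elementary_spanning H H' C E :
    elementary_subhypergraph H (e_index H) H' C E ->
  spanning_elementary (index_set H) (unified_graph H) C E.
Proof.
case/and5P=> _ /andP[_ sE] _ _.
case/and5P=> /forall_inP Ccyc /forall_inP Cdis EG' /eqP sz /forall_inP cond.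
have sG := unified_graph_sub sE.
have Ccyc' : {in C, forall c, graph_cycle (unified_graph H) c}.
  move=> c /Ccyc/exact_cycleP cyc; have [_ [_ _ _ cG']] := cyc.
  exact: graph_cycle_sub cyc (subset_trans cG' sG).
have EG : E \subset unified_graph H by apply: subset_trans EG' sG.
have E2 : {in E, forall P, #|P| = 2}.
  by move=> P /(subsetP EG); apply: card_unified_graph.
have Cinj : {in C &, injective (@cover {set T})}.
  move=> c c' cC c'C Ecov; apply/eqP/contraT => ncc'.
  have /forall_inP/(_ c' c'C)/implyP/(_ ncc') := Cdis c cC.
  rewrite -Ecov -setI_eq0 setIid => /eqP c0.
  by have := graph_cycle_gt2 (Ccyc' c cC); rewrite c0 cards0.
have CE c P A : c \in C -> P \in E -> A \in cover c -> A \in P -> False.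
  move=> cC PE Ac AP.
  have AE : A \in cover E by apply/bigcupP; exists P.
  have AC : A \in \bigcup_(c in C) cover c by apply/bigcupP; exists c.
  have := cond A; rewrite inE AE orbT AC => /(_ isT).
  by [].
have EE P P' A : P \in E -> P' \in E -> A \in P -> A \in P' -> P = P'.
  move=> PE P'E AP AP'; have AE : A \in cover E by apply/bigcupP; exists P.
  have := cond A; rewrite inE AE orbT => /(_ isT); case: ifP => // _.
  move=> le1; apply/eqP/contraT => nPP'.
  have /subset_leq_card: [set P; P'] \subset [set Q in E | A \in Q].
    by apply/subsetP=> Q; rewrite !inE => /orP[] /eqP->; rewrite ?PE ?P'E.
  by rewrite cards2 nPP' => /leq_trans/(_ le1).
have tB : trivIset (cover @: C :|: E).
  apply/trivIsetP=> A B AB BB; apply: contraR.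
  rewrite -setI_eq0 => /set0Pn[S /setIP[SA SB]].
  case/setUP: AB SA => [/imsetP[c cC ->]|AE] SA;
    case/setUP: BB SB => [/imsetP[c' c'C ->]|BE] SB.
  - have [-> //|ncc'] := eqVneq c c'.
    have /forall_inP/(_ c' c'C)/implyP/(_ ncc') := Cdis c cC.
    by rewrite -setI_eq0 => /eqP/setP/(_ S); rewrite !inE SA SB.
  - by have := CE _ _ _ cC BE SA SB.
  - by have := CE _ _ _ c'C AE SB SA.
  - by rewrite (EE _ _ _ AE BE SA SB).
split=> //; apply/and3P; split=> //.
  rewrite eqEcard; apply/andP; split.
    apply/bigcupsP=> B /setUP[/imsetP[c cC ->]|BE].
      have [_ [_ _ _ cG]] := Ccyc' c cC.
      apply: subset_trans (cover_unified_graph H).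
      apply/bigcupsP=> P Pc.
      by apply: (bigcup_max P) => //; apply: (subsetP cG).
    apply: subset_trans (cover_unified_graph H).
    by apply: (bigcup_max B) => //; apply: (subsetP EG).
  rewrite -/(e_index H) -sz -(sum_card_blocks Ccyc' Cinj E2).
  by move: tB; rewrite /trivIset => /eqP->.
rewrite inE negb_or; apply/andP; split; last first.
  by apply/negP=> /E2; rewrite cards0.
apply/imsetP=> -[c cC E0].
by have := graph_cycle_gt2 (Ccyc' c cC); rewrite -E0 cards0.
Qed.

Lemma simple_hypergraph_gt1 H e : e \in edges H -> 1 < #|e|.
Proof.
have /andP[_ /forall_inP ax] := valP H.
by move=> /ax/andP[].
Qed.

Lemma simple_hypergraph_edge_sub H e : e \in edges H -> e \subset vertices H.
Proof.
have /andP[_ /forall_inP ax] := valP H.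
by move=> /ax/andP[].
Qed.

Lemma index_set_neq0 H : index_set H != set0.
Proof.
have /andP[/set0Pn[x xH] _] := valP H.
by apply/set0Pn; exists [set x]; rewrite inE imset_f ?orbT.
Qed.

(** The subhypergraph consists of the edges partitioned by the components and of
    the vertices on these edges. *)
Lemma spanning_elementary_exists H C E :
    spanning_elementary (index_set H) (unified_graph H) C E ->
  exists H', elementary_subhypergraph H (e_index H) H' C E.
Proof.
case=> Ccyc Cinj EG Bpart.
have E2 : {in E, forall P, #|P| = 2}.
  by move=> P /(subsetP EG); apply: card_unified_graph.
have sum_k : e_index H = \sum_(c in C) #|c| + 2 * #|E|.
  by rewrite /e_index (card_partition Bpart) (sum_card_blocks Ccyc Cinj E2).
have /and3P[/eqP Bcov Btriv B0] := Bpart.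
set F := cover C :|: E; pose ed : {set {set T}} := [set cover P | P in F].
have FG : F \subset unified_graph H.
  rewrite subUset EG andbT; apply/bigcupsP=> c cC.
  by have [_ [_ _ _ ]] := Ccyc c cC.
have sEd : ed \subset edges H.
  by apply/subsetP=> _ /imsetP[P /(subsetP FG)/unified_graphP[] ? _ ->].
have [B BB] : exists B, B \in cover @: C :|: E.
  have /set0Pn[S] := index_set_neq0 H; rewrite -Bcov => /bigcupP[B BB _].
  by exists B.
have B2 : 2 <= #|B|.
  case/setUP: BB => [/imsetP[c cC ->]|/E2->//].
  exact/ltnW/(graph_cycle_gt2 (Ccyc c cC)).
have k2 : 2 <= e_index H.
  apply: leq_trans B2 _; apply: subset_leq_card.
  by rewrite -Bcov; apply: (bigcup_max B).
have [P PF] : exists P, P \in F.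
  case/setUP: BB => [/imsetP[c cC EB]|BE]; last first.
    by exists B; rewrite inE BE orbT.
  have /card_gt0P[P Pc] : 0 < #|c|.
    rewrite -(card_cover_graph_cycle (Ccyc c cC)).
    exact: leq_trans (graph_cycle_gt2 (Ccyc c cC)).
  by exists P; rewrite inE; apply/orP; left; apply/bigcupP; exists c.
have Ped : cover P \in ed by apply: imset_f.
have ax : simple_hypergraph_axiom (cover ed, ed).
  apply/andP; split=> /=.
    have /card_gt0P[x xP] : 0 < #|cover P|.
      exact/ltnW/(simple_hypergraph_gt1 (subsetP sEd _ Ped)).
    by apply/set0Pn; exists x; apply/bigcupP; exists (cover P).
  apply/forall_inP=> e eed; rewrite (simple_hypergraph_gt1 (subsetP sEd _ eed)).
  by rewrite andbT; apply: (bigcup_max e).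
pose H' := SimpleHypergraph ax; exists H'.
have FG' : F \subset unified_graph H'.
  apply/subsetP=> Q QF; apply/unified_graphP; split; first exact: imset_f.
  by have /unified_graphP[] := subsetP FG Q QF.
have FC c : c \in C -> c \subset F.
  by move=> cC; apply: subset_trans (subsetUl _ _); apply: (bigcup_max c).
have disB A B' : A \in cover @: C :|: E -> B' \in cover @: C :|: E -> A != B' ->
  [disjoint A & B'] by move=> *; apply: (trivIsetP Btriv).
apply/and5P; split.
- by rewrite k2 leqnn.
- rewrite /subhypergraph sEd andbT; apply/bigcupsP=> e /(subsetP sEd).
  exact: simple_hypergraph_edge_sub.
- exact: eqxx.
- exact: eqxx.
apply/and5P; split.
- apply/forall_inP=> c cC; apply/exact_cycleP.
  exact: graph_cycle_sub (Ccyc c cC) (subset_trans (FC c cC) FG').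
- apply/forall_inP=> c cC; apply/forall_inP=> c' c'C; apply/implyP=> ncc'.
  apply: disB; rewrite ?inE ?imset_f //.
  by apply: contraNneq ncc' => /Cinj->.
- exact: subset_trans (subsetUr _ _) FG'.
- by rewrite sum_k.
apply/forall_inP=> S _; case: ifP => [/bigcupP[c cC Sc]|_].
  apply/negP=> /bigcupP[Q QE SQ].
  have ncQ : cover c != Q.
    apply: contraTneq (graph_cycle_gt2 (Ccyc c cC)) => ->.
    by rewrite E2.
  have := disB (cover c) Q; rewrite !inE imset_f // QE orbT => /(_ isT isT ncQ).
  by rewrite -setI_eq0 => /eqP/setP/(_ S); rewrite !inE Sc SQ.
apply/card_le1_eqP=> P1 P2; rewrite !inE => /andP[P1E S1] /andP[P2E S2].
apply/eqP/contraT => nP12.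
have := disB P1 P2; rewrite !inE P1E P2E !orbT => /(_ isT isT).
rewrite eq_sym nP12 => /(_ isT).
by rewrite -setI_eq0 => /eqP/setP/(_ S); rewrite !inE S1 S2.
Qed.

(** This is why the sum over triplets is a sum over pairs: the subhypergraph
    has exactly the edges and vertices that the two other members use. *)
Lemma elementary_subhypergraph_unique H q H1 H2 C E :
    elementary_subhypergraph H q H1 C E ->
    elementary_subhypergraph H q H2 C E ->
  H1 = H2.
Proof.
case/and5P=> _ _ /eqP E1 /eqP V1 _ /and5P[_ _ /eqP E2 /eqP V2 _].
apply: val_inj => /=; have EE : edges H1 = edges H2 by rewrite E1 E2.
have VV : vertices H1 = vertices H2 by rewrite V1 V2 EE.
rewrite [LHS]surjective_pairing [RHS]surjective_pairing.
exact: (congr2 pair VV EE).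
Qed.

End UnifiedGraph.

Import GRing.Theory.
Local Open Scope ring_scope.

Theorem theorem6p1 (R : comNzRingType) (T : finType) (H : simple_hypergraph T) :
  \det (unified_matrix R H) =
  \sum_(H' : simple_hypergraph T)
    \sum_(C : {set {set {set {set T}}}})
      \sum_(E : {set {set {set T}}}
            | elementary_subhypergraph H (e_index H) H' C E)
        (-1) ^+ (e_index H - #|C| - #|E|)%N * 2 ^+ #|C|.
Proof.
have -> : unified_matrix R H =
    \matrix_(i, j) ([set enum_val i; enum_val j] \in unified_graph H)%:R.
  apply/matrixP=> i j; rewrite !mxE.
  have -> : [exists e in edges H,
      [set enum_val i; enum_val j] \in two_partitions e] =
      ([set enum_val i; enum_val j] \in unified_graph H).
    by apply/exists_inP/bigcupP=> -[e]; exists e.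
  by case: ifP.
rewrite harary_sachs; [|exact: enum_val_inj|exact: card_unified_graph].
have -> : enum_val @: [set: 'I_(e_index H)] = index_set H.
  apply/setP=> S; apply/imsetP/idP=> [[i _ ->]|SH]; first exact: enum_valP.
  by exists (enum_rank_in SH S); rewrite ?enum_rankK_in.
under [RHS]eq_bigr => H' _ do under eq_bigr => C _ do rewrite big_mkcond.
under [RHS]eq_bigr => H' _ do rewrite pair_bigA.
rewrite exchange_big big_mkcond; apply: eq_bigr => -[C E] _ /=.
case: asboolP => [/spanning_elementary_exists[H' HH']|nCE].
  rewrite (bigD1 H') //= HH' big1 ?addr0 // => H2 nH2.
  case: ifP => // /elementary_subhypergraph_unique/(_ HH') E2.
  by rewrite E2 eqxx in nH2.
by rewrite big1 // => H' _; case: ifP => // /elementary_spanning.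
Qed.
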